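(* Let $\Pi$ be a class of subsets of $[K]$ such that for every $k\in[K]$ there exist $A,B\in\Pi$ with $k\in A$, $k\notin B$. Suppose that for every $\alpha,\beta\in(0,1)$ the thresholds $a,b$ of the parallel SPRT $\tilde\chi$ are chosen so that $\tilde\chi\in\Delta(\alpha,\beta,\Pi)$, and that $a\sim|\log\alpha|$, $b\sim|\log\beta|$ as $\alpha,\beta\to0$. Suppose that for every $k\in[K]$ there are positive $I_k,J_k$ such that $\mathrm P_k^1(\limsup_n\lambda_k(n)/n\le I_k)=1$, $\mathrm P_k^0(\limsup_n(-\lambda_k(n))/n\le J_k)=1$, and for every $\epsilon>0$, $\sum_n\mathrm P_k^1(\lambda_k(n)/n\le I_k-\epsilon)<\infty$ and $\sum_n\mathrm P_k^0(-\lambda_k(n)/n\le J_k-\epsilon)<\infty$. Then, as $\alpha,\beta\to0$, $$\mathrm E_A[\tilde T_i]\sim\mathcal L'_{i,A}(\alpha,\beta,\Pi)\sim\frac{|\log\alpha|}{I_i},\qquad \mathrm E_A[\tilde T_j]\sim\mathcal L'_{j,A}(\alpha,\beta,\Pi)\sim\frac{|\log\beta|}{J_j},$$ simultaneously for every $i\in A$, $j\notin A$, $A\in\Pi$.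
   Context: Let $K\ge1$, $[K]=\{1,\dots,K\}$, $\mathbb N=\{1,2,\dots\}$. There are $K$ independent data streams $X_k=\{X_k(n):n\in\mathbb N\}$; $\mathcal F_k(n)=\sigma(X_k(t):t\le n)$, $\mathcal F(n)=\sigma(\mathcal F_k(n):k\in[K])$. For each $k$, $\mathrm P_k^0,\mathrm P_k^1$ are distributions of $X_k$ mutually absolutely continuous on each $\mathcal F_k(n)$, $\lambda_k(n)=\log\frac{d\mathrm P_k^1}{d\mathrm P_k^0}(\mathcal F_k(n))$. For $A\subseteq[K]$, $\mathrm P_A$ is the joint law with independent streams, $X_k\sim\mathrm P_k^1$ if $k\in A$, $\mathrm P_k^0$ otherwise; $\mathrm E_A$ its expectation. A procedure $\chi=(\mathbf T,\mathbf D)$: $\mathbb N$-valued stopping times $T_k$ w.r.t. $\{\mathcal F(n)\}$ and $\mathcal F(T_k)$-measurable Bernoulli $D_k$. It is decentralized if each $T_k$ is a stopping time w.r.t. $\{\mathcal F_k(n)\}$ and $D_k$ is $\mathcal F_k(T_k)$-measurable; $\Delta'$ denotes the decentralized procedures. $\mathrm{FWE}^1_A(\chi)=\mathrm P_A(\exists j\notin A:D_j=1)$, $\mathrm{FWE}^2_A(\chi)=\mathrm P_A(\exists i\in A:D_i=0)$. $\Delta(\alpha,\beta,\Pi)$: procedures with $\mathrm{FWE}^1_A\le\alpha$ and $\mathrm{FWE}^2_A\le\beta$ for all $A\in\Pi$. $\mathcal L'_{k,A}(\alpha,\beta,\Pi)=\inf\{\mathrm E_A[T_k]:\chi\in\Delta'\cap\Delta(\alpha,\beta,\Pi)\}$.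 Parallel SPRT $\tilde\chi$ (thresholds $a,b>0$): $\tilde T_k=\inf\{n:\lambda_k(n)\notin(-b,a)\}$, $\tilde D_k=\mathbf 1\{\lambda_k(\tilde T_k)\ge a\}$. $x\sim y$ means $x/y\to1$. *)

(* Defs.v *)
From HB Require Import structures.
From mathcomp Require Import all_boot all_order all_algebra.
From mathcomp Require Import all_classical all_reals all_analysis.
Set Implicit Arguments. Unset Strict Implicit. Unset Printing Implicit Defensive.
Import Order.TTheory GRing.Theory Num.Theory.
Import numFieldNormedType.Exports.
Local Open Scope classical_set_scope.
Local Open Scope ring_scope.

(* Setting: an abstract measurable space Omega carrying the K data streams
   X k : nat -> Omega -> S (X k n = X_k(n), n = 1,2,...; the value at n = 0
   is never used), all taking values in a common measurable space S. *)

Section Defs.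
Context {R : realType} {d : measure_display} {Omega : measurableType d}
        {dS : measure_display} {S : measurableType dS} {K : nat}.
Variable X : 'I_K -> nat -> Omega -> S.

Definition Fk (k : 'I_K) (n : nat) : set (set Omega) :=
  <<s [set E | exists t B, (1 <= t <= n)%N /\ measurable B /\ E = X k t @^-1` B] >>.

Definition Fall (n : nat) : set (set Omega) :=
  <<s [set E | exists k t B, (1 <= t <= n)%N /\ measurable B /\ E = X k t @^-1` B] >>.

Definition sigmaX (k : 'I_K) : set (set Omega) :=
  <<s [set E | exists t B, (1 <= t)%N /\ measurable B /\ E = X k t @^-1` B] >>.

Definition stopping_time (F : nat -> set (set Omega)) (T : Omega -> nat) :=
  (forall w, (1 <= T w)%N) /\ forall n, F n [set w | T w = n].

Definition in_stopped (F : nat -> set (set Omega)) (T : Omega -> nat) (E : set Omega) :=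
  forall n, F n (E `&` [set w | T w = n]).

Definition procedure (T : 'I_K -> Omega -> nat) (D : 'I_K -> Omega -> bool) :=
  forall k, stopping_time Fall (T k) /\ in_stopped Fall (T k) [set w | D k w].

Definition decentralized (T : 'I_K -> Omega -> nat) (D : 'I_K -> Omega -> bool) :=
  procedure T D /\
  forall k, stopping_time (Fk k) (T k) /\ in_stopped (Fk k) (T k) [set w | D k w].

Variable P : {set 'I_K} -> probability Omega R.

Definition FWE1 (A : {set 'I_K}) (D : 'I_K -> Omega -> bool) : \bar R :=
  P A [set w | exists j, j \notin A /\ D j w].
Definition FWE2 (A : {set 'I_K}) (D : 'I_K -> Omega -> bool) : \bar R :=
  P A [set w | exists i, i \in A /\ ~~ D i w].

Definition errors_ok (Pi : {set {set 'I_K}}) (alpha beta : R) (D : 'I_K -> Omega -> bool) :=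
  forall A, A \in Pi -> (FWE1 A D <= alpha%:E)%E /\ (FWE2 A D <= beta%:E)%E.

Definition Lprime (Pi : {set {set 'I_K}}) (alpha beta : R) (k : 'I_K) (A : {set 'I_K}) : \bar R :=
  ereal_inf [set x | exists T D, decentralized T D /\ errors_ok Pi alpha beta D /\
                                 x = (\int[P A]_w ((T k w)%:R)%:E)%E].

Variable lam : 'I_K -> nat -> Omega -> R.

(* Parallel SPRT with thresholds a, b.  The stopping time is extended-real
   valued (+oo if no exit occurs); on that event, which is P_A-null under the
   hypotheses of the theorem, the decision is set to 0. *)
Definition sprt_T (a b : R) (k : 'I_K) (w : Omega) : \bar R :=
  ereal_inf [set (n%:R)%:E | n in [set n | (1 <= n)%N /\ ~ (- b < lam k n w < a)]].

Definition sprt_D (a b : R) (k : 'I_K) (w : Omega) : bool :=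
  `[< exists n, [/\ (1 <= n)%N, ~ (- b < lam k n w < a),
        (forall m, (1 <= m < n)%N -> - b < lam k m w < a) & a <= lam k n w] >].

End Defs.

(* f ~ g as (alpha, beta) -> (0, 0) within (0,1)^2, for g > 0 there:
   f / g -> 1, written out. *)
Definition asym_eq00 {R : realType} (f : R -> R -> \bar R) (g : R -> R -> R) :=
  forall e : R, 0 < e -> exists2 del : R, 0 < del &
    forall al be : R, 0 < al < del -> 0 < be < del -> al < 1 -> be < 1 ->
      (((1 - e) * g al be)%:E <= f al be)%E /\ (f al be <= ((1 + e) * g al be)%:E)%E.

(* Main.v *)
(* Optimality: if a test with the prescribed error probabilities stops stream k
   before (1 - e)|log alpha| / I_k with non-negligible probability under P_k^1,
   then, since lambda_k is unlikely to exceed (1 - e/4)|log alpha| that early,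
   changing measure at the stopping time to P_k^0 costs a factor at most
   alpha^-(1 - e/4), so the type I error would exceed alpha; streams with no
   signal are symmetric, with beta, J_k and -lambda_k.
   Conversely the SPRT time is at most a/(I_k - eps) plus the number of n with
   lambda_k(n)/n <= I_k - eps, which has finite mean.  The SPRT need not stop
   everywhere, so it is compared with L' through its truncation at a late
   horizon, feasible for (alpha, 2 beta); doubling beta does not change the
   asymptotics. *)
Require Import Defs.
From HB Require Import structures.
From mathcomp Require Import all_boot all_order all_algebra.
From mathcomp Require Import all_classical all_reals all_analysis.
From mathcomp Require Import measurable_realfun zify lra ring.
Set Implicit Arguments. Unset Strict Implicit. Unset Printing Implicit Defensive.
Import Order.TTheory GRing.Theory Num.Theory.
Import numFieldNormedType.Exports.
Local Open Scope classical_set_scope.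
Local Open Scope ring_scope.

(** * Measure-theoretic preliminaries *)

Lemma le_measure_bigcup d (T : measurableType d) (R : realType)
    (mu nu : {measure set T -> \bar R}) (x : R) (G : nat -> set T) :
  trivIset setT G -> (forall n, measurable (G n)) ->
  (forall n, (mu (G n) <= x%:E * nu (G n))%E) ->
  (mu (\bigcup_n G n) <= x%:E * nu (\bigcup_n G n))%E.
Proof.
move=> tG mG le_mu_nu.
rewrite !measure_bigcup// -nneseriesZl//.
exact: lee_nneseries.
Qed.

Lemma measure_finite_union_le d (T : measurableType d) (R : realType)
    (mu : {measure set T -> \bar R}) (I : finType) (E : set T) (G : I -> set T)
    (x : R) :
  measurable E -> (forall i, measurable (G i)) -> E `<=` \bigcup_i G i ->
  (forall i, (mu (G i) <= x%:E)%E) -> (mu E <= (x *+ #|I|)%:E)%E.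
Proof.
move=> mE mG EG le_mu.
have fI : finite_set [set: I] by exact: finite_finset.
apply: (le_trans (content_sub_fsum mu fI (fun i _ => mG i) mE EG)).
rewrite (fsbigE (enum I)) ?enum_uniq//; last by move=> i _; rewrite mem_enum.
rewrite big_enum_cond/=; apply: (@le_trans _ _ (\sum_(i : I) x%:E)%E).
  by rewrite big_mkcond/=; apply: lee_sum => i _; rewrite in_setT.
by rewrite sumEFin sumr_const.
Qed.

Lemma limn_esup_ub_eventually (R : realType) (u : nat -> R) (l : R) :
  (limn_esup (fun n => (u n)%:E) < l%:E)%E ->
  exists N, forall n, (N <= n)%N -> u n < l.
Proof.
move=> /ereal_inf_lt[_ [V [N _ NV] <-] ltl]; exists N => n Nn.
rewrite -lte_fin; apply: le_lt_trans ltl; apply: ereal_sup_ubound.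
by exists n => //; apply: NV.
Qed.

Lemma cvge0_eventually_lt (R : realType) (u : nat -> \bar R) (del : R) :
  u @ \oo --> 0%E -> 0 < del -> \forall n \near \oo, (u n < del%:E)%E.
Proof.
move=> u0 del0; apply: (u0 [set x | (x < del%:E)%E]).
by apply: open_nbhs_nbhs; split; [exact: open_ereal_lt_ereal|rewrite /= lte_fin].
Qed.

(** * The running maximum of a process with bounded growth rate *)

Lemma measurable_running_max d (T : measurableType d) (R : realType)
    (l : nat -> T -> R) (c : R) (m : nat) :
  (forall n, (1 <= n)%N -> measurable [set w | l n w <= c]) ->
  measurable [set w | exists n, (1 <= n <= m)%N /\ (c < l n w)%R].
Proof.
move=> ml.
rewrite (_ : mkset _ = \bigcup_(n in [set n | (1 <= n <= m)%N]) ~` [set w | (l n w <= c)%R]).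
  by apply: bigcup_measurable => n /andP[n1 _]; apply: measurableC; exact: ml.
apply/seteqP; split=> [w [n [nm lw]]|w [n nm /= /negP lw]]; exists n => //.
  by apply/negP; rewrite -ltNge.
by rewrite ltNge.
Qed.

(** Where the limsup is at most [I], late values stay below [n%:R * (I + eps)], hence below the
    level at horizon [m], and the finitely many early values are overtaken by that level as [m]
    grows. So almost every path lies in only finitely many [E m]; continuity from above of the tail
    unions [F m] concludes. *)
Lemma running_max_small d (T : measurableType d) (R : realType)
    (Q : probability T R) (l : nat -> T -> R) (I eps : R) :
  (forall n, (1 <= n)%N -> measurable_fun setT (l n)) ->
  0 < I -> 0 < eps ->
  Q [set w | (limn_esup (fun n => (l n w / n%:R)%:E) <= I%:E)%E] = 1%E ->
  forall del : R, 0 < del -> exists M, forall m, (M <= m)%N ->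
    (Q [set w | exists n, (1 <= n <= m)%N /\ (m%:R * (I + eps) < l n w)%R] <= del%:E)%E.
Proof.
move=> ml I0 e0 Q1 del del0.
have Ie0 : 0 < I + eps by exact: addr_gt0.
pose E m := [set w | exists n, (1 <= n <= m)%N /\ (m%:R * (I + eps) < l n w)%R].
have mle n c : (1 <= n)%N -> measurable [set w | l n w <= c].
  move=> n1; rewrite (_ : mkset _ = l n @^-1` `]-oo, c]); last first.
    by apply/seteqP; split=> w /=; rewrite in_itv.
  by rewrite -[X in measurable X]setTI; exact: ml.
have mE m : measurable (E m) by apply: measurable_running_max => n; exact: mle.
pose F m := \bigcup_(k in [set k | (m <= k)%N]) E k.
have mF m : measurable (F m) by exact: bigcup_measurable.
have mcapF : measurable (\bigcap_m F m) by exact: bigcapT_measurable.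
pose G := [set w | (limn_esup (fun n => (l n w / n%:R)%:E) <= I%:E)%E].
have mG : measurable G.
  rewrite (_ : G = (fun w => limn_esup (fun n => (l n w / n%:R)%:E)) @^-1` `]-oo, I%:E]); last first.
    by apply/seteqP; split=> w /=; rewrite in_itv.
  rewrite -[X in measurable X]setTI.
  apply: (measurable_fun_limn_esup (f := fun n w => (l n w / n%:R)%:E)); [|exact: measurableT|exact: emeasurable_itv].
  move=> [|n]; apply/measurable_EFinP.
    (* At [n = 0] division by zero yields the constant 0, which settles the one index where [l] is
       not assumed measurable. *)
    rewrite (_ : (fun w => _) = cst 0); first exact: measurable_cst.
    by apply/funext => w; rewrite invr0 mulr0.
  by apply: measurable_funM; [exact: ml|exact: measurable_cst].
have capF : \bigcap_m F m `<=` ~` G.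
  move=> w Fw Gw.
  have [N ltN] : exists N, forall n, (N <= n)%N -> l n w / n%:R < I + eps.
    apply: limn_esup_ub_eventually; apply: le_lt_trans Gw _.
    by rewrite lte_fin ltrDl.
  pose s := \sum_(i < N) `|l i w|.
  (* The horizon is taken so late that [k%:R * (I + eps)] exceeds [s], a bound for every value
     before [N]. *)
  have [k Nsk [n [/andP[n1 nk] lt_l]]] := Fw (Num.trunc (s / (I + eps))).+1 Logic.I.
  have [Nn|nN] := leqP N n.
    have := ltN n Nn; rewrite ltr_pdivrMr ?ltr0n// mulrC => ltn.
    have := lt_trans lt_l ltn; rewrite ltr_pM2r// ltr_nat; lia.
  have ls : l n w <= s.
    rewrite /s (bigD1 (Ordinal nN))//=; apply: (le_trans (ler_norm _)).
    by rewrite lerDl sumr_ge0.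
  have := lt_le_trans lt_l ls; apply/negP; rewrite -leNgt -ler_pdivrMr//.
  apply: le_trans (ltW (truncnS_gt _)) _; by rewrite ler_nat.
have Q0 : Q (\bigcap_m F m) = 0%E.
  apply/eqP; rewrite eq_le measure_ge0 andbT.
  apply: le_trans (_ : (Q (~` G) <= _)%E).
    by apply: le_measure => //; rewrite inE; [exact: mcapF|exact: measurableC].
  by rewrite probability_setC// -/G Q1 subee.
have : (Q \o F) x @[x --> \oo] --> (0 : \bar R)%E.
  rewrite -Q0; apply: nonincreasing_cvg_mu => //.
    by rewrite (le_lt_trans (probability_le1 _ _))// ltry.
  move=> n m nm; apply/subsetPset => w [k /= mk Ek]; exists k => //=.
  exact: leq_trans mk.
move=> /cvge0_eventually_lt/(_ del0)[M _ FM]; exists M => m Mm.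
apply: le_trans (ltW (FM m Mm)); apply: le_measure; rewrite ?inE.
- exact: mE.
- exact: mF.
- by move=> w Ew; exists m => /=.
Qed.

(** * Lower bound for expected stopping times by change of measure *)

Lemma sigma_algebra_setI (T : pointedType) (G : set (set T)) (A B : set T) :
  sigma_algebra setT G -> G A -> G B -> G (A `&` B).
Proof.
move=> sG; rewrite -(measurable_g_measurableTypeE sG) => mA mB.
exact: measurableI.
Qed.

(* On [H], up to the event that [l] exceeds [c] before time [m], stopping at [n]
   costs at most a factor [x] in passing from [Q1] to [Q0]. *)
Lemma early_stopping_bound d (Om : measurableType d) (R : realType)
    (Q1 Q0 : probability Om R) (T : Om -> nat) (H : set Om)
    (l : nat -> Om -> R) (c x : R) (m : nat) :
  (forall n, measurable [set w | T w = n]) -> (forall w, (1 <= T w)%N) ->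
  measurable H ->
  (forall n, (1 <= n)%N -> measurable [set w | l n w <= c]) ->
  0 <= x ->
  (forall n, (1 <= n)%N ->
    (Q1 (H `&` [set w | T w = n] `&` [set w | (l n w <= c)%R]) <=
     x%:E * Q0 (H `&` [set w | T w = n] `&` [set w | (l n w <= c)%R]))%E) ->
  (Q1 [set w | (T w <= m)%N] <= Q1 (~` H) +
     (Q1 [set w | exists n, (1 <= n <= m)%N /\ (c < l n w)%R] + x%:E * Q0 H))%E.
Proof.
move=> mT T1 mH ml x0 hx.
pose E := [set w | exists n, (1 <= n <= m)%N /\ (c < l n w)%R].
have mE : measurable E by exact: measurable_running_max.
(* [G 0] is empty since times start at 1, where the comparison of [Q1] and [Q0] is available. *)
pose G n := if n is 0 then set0
  else H `&` [set w | T w = n] `&` [set w | (l n w <= c)%R].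
have mG n : measurable (G n).
  case: n => [|n]; first exact: measurable0.
  apply: measurableI; last exact: ml.
  by apply: measurableI; [exact: mH|exact: mT].
have tG : trivIset setT G.
  apply/trivIsetP => -[|i] [|j] _ _ ij; rewrite ?set0I ?setI0//.
  apply/seteqP; split=> // w [[[_ /= Ti] _] [[_ /= Tj] _]].
  by move: ij; rewrite -Ti -Tj eqxx.
have GH : \bigcup_n G n `<=` H by move=> w [[//|n] _ [[]]].
have mUG : measurable (\bigcup_n G n) by exact: bigcupT_measurable.
have Q1G : (Q1 (\bigcup_n G n) <= x%:E * Q0 H)%E.
  apply: (@le_trans _ _ (x%:E * Q0 (\bigcup_n G n))%E).
    apply: le_measure_bigcup => // -[|n]; last exact: hx.
    by rewrite /= !measure0 mule0.
  by rewrite lee_wpmul2l ?lee_fin//; apply: le_measure; rewrite ?inE.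
have mTm : measurable [set w | (T w <= m)%N].
  rewrite (_ : mkset _ = \bigcup_(n in [set n | (n <= m)%N]) [set w | T w = n]).
    by apply: bigcup_measurable => n _; exact: mT.
  by apply/seteqP; split=> [w /= Tm|w [n /= nm ->//]]; exists (T w).
have mCH := measurableC mH.
(* A path stopped by time [m] lies outside [H], or has [l] above [c] when stopped, or falls in the
   slice [G (T w)]. *)
apply: (@le_trans _ _ (Q1 (~` H `|` (E `|` \bigcup_n G n)))).
  apply: le_measure; rewrite ?inE//; first by do 2 apply: measurableU => //.
  move=> w /= Tm; have [Hw|] := pselect (H w); last by left.
  right; have [lw|lw] := leP (l (T w) w) c.
    have GT : G (T w) = H `&` [set v | T v = T w] `&` [set v | (l (T w) v <= c)%R].
      by move: (T1 w); rewrite /G; case: (T w).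
    by right; exists (T w) => //; rewrite GT.
  by left; exists (T w); rewrite T1 Tm.
apply: (le_trans (measureU2 _ _ _)) => //; first exact: measurableU.
rewrite leeD2l//; apply: (le_trans (measureU2 _ _ _)) => //.
by rewrite leeD2l.
Qed.

Lemma measurable_nat_time d (Om : measurableType d) (R : realType)
    (T : Om -> nat) : (forall n, measurable [set w | T w = n]) ->
  measurable_fun setT (fun w => ((T w)%:R)%:E : \bar R).
Proof.
move=> mT; apply/measurable_EFinP.
apply: (@measurableT_comp _ _ _ _ _ _ (fun n : nat => n%:R : R) _ T) => //.
move=> _ B _; rewrite setTI (_ : _ @^-1` _ = \bigcup_(n in B) [set w | T w = n]).
  by apply: bigcup_measurable => n _; exact: mT.
by apply/seteqP; split=> [w Bw|w [n Bn /= ->//]]; exists (T w).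
Qed.

Lemma measurable_in_stopped d (Om : measurableType d)
    (F : nat -> set (set Om)) (T : Om -> nat) (H : set Om) :
  (forall n, F n `<=` measurable) -> in_stopped F T H -> measurable H.
Proof.
move=> Fm FH; rewrite (_ : H = \bigcup_n (H `&` [set w | T w = n])).
  by apply: bigcupT_measurable => n; apply: (Fm n); exact: FH.
by apply/seteqP; split=> [w Hw|w [n _ []//]]; exists (T w).
Qed.

(** Markov's inequality: off the event [T w <= m] the time is at least [m.+1], hence at least the
    real number [t]. *)
Lemma integral_ge_tail d (Om : measurableType d) (R : realType)
    (Q : probability Om R) (T : Om -> nat) (t : R) (m : nat) :
  (forall n, measurable [set w | T w = n]) -> 0 <= t <= m.+1%:R ->
  (t%:E * (1 - Q [set w | (T w <= m)%N]) <= \int[Q]_w ((T w)%:R)%:E)%E.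
Proof.
move=> mT /andP[t0 tm].
have mTm : measurable [set w | (T w <= m)%N].
  rewrite (_ : mkset _ = \bigcup_(n in [set n | (n <= m)%N]) [set w | T w = n]).
    by apply: bigcup_measurable => n _; exact: mT.
  by apply/seteqP; split=> [w /= Tm|w [n /= nm ->//]]; exists (T w).
have mC := measurableC mTm.
have mfT := @measurable_nat_time _ _ R _ mT.
rewrite -probability_setC// -integral_cst//.
apply: (@le_trans _ _ (\int[Q]_(w in ~` [set w | (T w <= m)%N]) ((T w)%:R)%:E)%E).
  apply: ge0_le_integral => //; [exact: measurable_funTS|].
  move=> w /= /negP; rewrite -ltnNge lee_fin => mT'.
  by apply: (le_trans tm); rewrite ler_nat.
by apply: ge0_subset_integral.
Qed.

(** [H] is the decision in favour of [Q1], so the two probability bounds are the test's errors.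
    Keeping [l] and the two laws abstract lets the same bound serve the log-likelihood ratio and its
    negative. Choosing [del] before the test makes the bound uniform over tests, as an infimum
    requires. *)
Lemma expected_time_lower_bound d (Om : measurableType d) (R : realType)
    (Q1 Q0 : probability Om R) (F : nat -> set (set Om))
    (l : nat -> Om -> R) (I : R) :
  (forall n, sigma_algebra setT (F n)) ->
  (forall n, F n `<=` measurable) ->
  (forall n B, (1 <= n)%N -> measurable B -> F n (l n @^-1` B)) ->
  (forall n E c, (1 <= n)%N -> F n E -> E `<=` [set w | (l n w <= c)%R] ->
    (Q1 E <= (expR c)%:E * Q0 E)%E) ->
  0 < I ->
  (forall del : R, 0 < del -> forall eps : R, 0 < eps -> exists M, forall m, (M <= m)%N ->
    (Q1 [set w | exists n, (1 <= n <= m)%N /\ (m%:R * (I + eps) < l n w)%R] <= del%:E)%E) ->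
  forall e : R, 0 < e -> exists2 del : R, 0 < del & forall (al be : R) (T : Om -> nat) (H : set Om),
    0 < al < del -> 0 < be < del -> stopping_time F T -> in_stopped F T H ->
    (Q0 H <= al%:E)%E -> (Q1 (~` H) <= be%:E)%E ->
    (((1 - e) * (`|ln al| / I))%:E <= \int[Q1]_w ((T w)%:R)%:E)%E.
Proof.
move=> sF Fm lF chg I0 tail e e0.
have [e1|e1] := leP 1 e.
  exists 1 => // al be T H _ _ _ _ _ _; apply: (@le_trans _ _ 0%E).
    by rewrite lee_fin mulr_le0_ge0 ?subr_le0// divr_ge0// ltW.
  by apply: integral_ge0.
have e60 : 0 < e / 6 by rewrite divr_gt0.
have eps0 : 0 < I * e / 4 by rewrite divr_gt0 ?mulr_gt0.
have [M tailM] := tail _ e60 _ eps0.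
(* With [L] the modulus of [ln al], the first entry makes [expR (- (e / 4 * L))] at most [e / 6];
   the second pushes the horizon [t] beyond [M]. *)
pose L0 := Num.max (4 / e * - ln (e / 6)) (M%:R * I / (1 - e / 2)).
exists (Num.min (expR (- L0)) (Num.min 1 (e / 6))).
  by rewrite !lt_min expR_gt0 ltr01 e60.
move=> al be T H; rewrite !lt_min => /andP[al0 /and3P[alL al1 _]] /andP[_ /and3P[_ _ be6]].
move=> [T1 FT] FH Q0H Q1H.
pose L := `|ln al|.
have LE : L = - ln al by rewrite /L ler0_norm// ln_le0// ltW.
have LL0 : L0 < L.
  by rewrite LE ltrNr -ltr_expR lnK.
have L01 : 4 / e * - ln (e / 6) < L by apply: le_lt_trans LL0; rewrite le_max lexx.
have L02 : M%:R * I / (1 - e / 2) < L by apply: le_lt_trans LL0; rewrite le_max lexx orbT.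
have e2 : 0 < 1 - e / 2 by lra.
pose t := (1 - e / 2) * L / I.
have tM : M%:R <= t.
  by move: L02; rewrite ltr_pdivrMr// /t ler_pdivlMr// => /ltW; rewrite [L * _]mulrC.
have t0 : 0 <= t by apply: le_trans tM.
pose m := Num.trunc t.
have mM : (M <= m)%N by rewrite truncn_ge_nat.
have mt : m%:R <= t by rewrite truncn_le.
have tm : t < m.+1%:R by exact: truncnS_gt.
(* Since [(1 - e / 2) * (1 + e / 4) <= 1 - e / 4], the growth level at horizon [m] stays below [c],
   while [expR c * al] is [al] to the power [e / 4], still small. *)
pose c := (1 - e / 4) * L.
have L0' : 0 <= L by rewrite /L.
have mc : m%:R * (I + I * e / 4) <= c.
  apply: (@le_trans _ _ (t * (I + I * e / 4))).
    by rewrite ler_wpM2r// addr_ge0// ltW.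
  rewrite /t /c.
  have -> : (1 - e / 2) * L / I * (I + I * e / 4) = (1 - e / 4 - e ^+ 2 / 8) * L.
    by field; rewrite gt_eqF.
  by apply: ler_wpM2r => //; rewrite gerDl oppr_le0 divr_ge0// sqr_ge0.
have xal : expR c * al <= e / 6.
  rewrite -[X in _ * X]lnK ?posrE// -expRD -[leRHS]lnK ?posrE// ler_expR.
  have -> : ln al = - L by rewrite LE opprK.
  have : e / 4 * (4 / e * - ln (e / 6)) <= e / 4 * L by rewrite ler_pM2l ?divr_gt0// ltW.
  have -> : e / 4 * (4 / e * - ln (e / 6)) = - ln (e / 6) by field; rewrite gt_eqF.
  by rewrite /c; lra.
have mT n : measurable [set w | T w = n] by apply: (Fm n); exact: FT.
have mH : measurable H by exact: measurable_in_stopped FH.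
have Fl y n : (1 <= n)%N -> F n [set w | (l n w <= y)%R].
  move=> n1; rewrite (_ : mkset _ = l n @^-1` `]-oo, y]); last first.
    by apply/seteqP; split=> w /=; rewrite in_itv.
  by apply: lF.
have early := @early_stopping_bound _ Om R Q1 Q0 T H l c (expR c) m mT T1 mH
  (fun n n1 => Fm n _ (Fl c n n1)) (expR_ge0 c).
(* The missed detection, the excess of [l] over [c] and the transferred false alarm cost [e / 6]
   each. With the horizon factor this leaves [(1 - e / 2) ^+ 2 >= 1 - e]. *)
have QT : (Q1 [set w | (T w <= m)%N] <= (e / 2)%:E)%E.
  apply: le_trans (early _) _.
    move=> n n1; apply: (chg n _ c n1).
      by apply: sigma_algebra_setI; [exact: sF|exact: FH|exact: Fl].
    by move=> w [].
  have -> : e / 2 = e / 6 + (e / 6 + e / 6) by lra.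
  rewrite !EFinD leeD//; first by apply: (le_trans Q1H); rewrite lee_fin ltW.
  apply: leeD.
    apply: le_trans (tailM m mM); apply: le_measure; rewrite ?inE.
    - exact: measurable_running_max (fun n n1 => Fm n _ (Fl c n n1)).
    - exact: measurable_running_max (fun n n1 => Fm n _ (Fl _ n n1)).
    - by move=> w [n [nm lw]]; exists n; split=> //; exact: le_lt_trans lw.
  apply: (@le_trans _ _ ((expR c)%:E * al%:E)%E).
    by rewrite lee_wpmul2l// lee_fin expR_ge0.
  by rewrite -EFinM lee_fin.
have tmb : 0 <= t <= m.+1%:R by rewrite t0 ltW.
apply: le_trans (integral_ge_tail Q1 mT tmb).
apply: (@le_trans _ _ (t%:E * (1 - (e / 2)%:E))%E); last first.
  by rewrite lee_wpmul2l ?lee_fin// leeB.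
rewrite -EFinB -EFinM lee_fin /t -/L.
have -> : (1 - e / 2) * L / I * (1 - e / 2) = (1 - e + e ^+ 2 / 4) * (L / I).
  by field; rewrite gt_eqF.
by rewrite ler_wpM2r ?lerDl ?divr_ge0 ?sqr_ge0 ?(ltW I0).
Qed.

(** * Upper bound for expected exit times and the resulting asymptotics *)

(** Every [n > M] with [n < T w] puts [w] in [B n], so [T w] exceeds [M.+1] by at most the number of
    such [n]; the count is integrated termwise. *)
Lemma expected_time_le_series d (Om : measurableType d) (R : realType)
    (Q : probability Om R) (T : Om -> \bar R) (B : nat -> set Om) (M : nat) :
  measurable_fun setT T -> (forall w, 0 <= T w)%E ->
  (forall n, (1 <= n)%N -> measurable (B n)) ->
  (forall n w, (M < n)%N -> ~ B n w -> (T w <= n%:R%:E)%E) ->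
  (\int[Q]_w T w <= M.+1%:R%:E + \sum_(1 <= n <oo) Q (B n))%E.
Proof.
move=> mT T0 mB TB.
pose h k w := (\1_(B k.+1) w)%:E : \bar R.
have h0 k w : (0 <= h k w)%E by rewrite lee_fin.
have mh k : measurable_fun setT (h k).
  by apply/measurable_EFinP/measurable_indic; exact: mB.
have TS w : (T w <= M.+1%:R%:E + \sum_(0 <= k <oo) h k w)%E.
  (* Scanning the times after [M]: either some time outside its [B] has already bounded [T w], or
     all [j] times scanned were counted. *)
  have part j : (T w <= M.+1%:R%:E + \sum_(0 <= k < M + j) h k w)%E \/
      (j%:R%:E <= \sum_(0 <= k < M + j) h k w)%E.
    elim: j => [|j [IH|IH]]; first by right; rewrite sume_ge0.
      left; apply: (le_trans IH); rewrite leeD2l// addnS big_nat_recr//=.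
      by rewrite leeDl.
    rewrite addnS big_nat_recr//=; have [Bw|nBw] := pselect (B (M + j).+1 w).
      by right; rewrite -natr1 EFinD leeD// /h indicE mem_set.
    left; apply: le_trans (TB _ _ _ nBw) _; first by rewrite ltnS leq_addr.
    rewrite -addSn natrD EFinD leeD2l//; apply: (le_trans IH).
    by rewrite leeDl.
  have sumle j : (\sum_(0 <= k < M + j) h k w <= \sum_(0 <= k <oo) h k w)%E.
    by apply: nneseries_lim_ge.
  have [[j Tj]|nT] := pselect (exists j, (T w <= M.+1%:R%:E + \sum_(0 <= k < M + j) h k w)%E).
    by apply: (le_trans Tj); rewrite leeD2l.
  (* If no scan ever bounds [T w], the partial counts exceed every [j] and the bound is infinite. *)
  suff -> : (\sum_(0 <= k <oo) h k w = +oo)%E by rewrite addey ?leey.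
  apply/eqyP => y y0; apply: (@le_trans _ _ (Num.trunc y).+1%:R%:E).
    by rewrite lee_fin ltW// truncnS_gt.
  by case: (part (Num.trunc y).+1) => [Tj|/le_trans->//]; exfalso; apply: nT; eexists; exact: Tj.
apply: (@le_trans _ _ (\int[Q]_w (M.+1%:R%:E + \sum_(0 <= k <oo) h k w))%E).
  apply: ge0_le_integral => //.
  by apply: emeasurable_funD => //; exact: ge0_emeasurable_sum.
rewrite ge0_integralD//=; last 2 first.
- by move=> w _; exact: nneseries_ge0.
- exact: ge0_emeasurable_sum.
rewrite integral_cst//= [Q _]probability_setT mule1 leeD2l// integral_nneseries//.
rewrite -(nneseries_addn (f := fun n => Q (B n)) 1)//.
apply: lee_nneseries => [i _ _|n _]; first exact: integral_ge0.
by rewrite integral_indic ?setIT ?addn1//; exact: mB.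
Qed.

(** Past [a / (I - eps)], any time with [l n / n > I - eps] has [l n] above [a], so the process has
    stopped. The remaining times have a finite expected number, fixed once [e] is, and this constant
    is absorbed because [g] tends to infinity. *)
Lemma expected_time_upper_asym d (Om : measurableType d) (R : realType)
    (Q : probability Om R) (T : R -> R -> Om -> \bar R)
    (l : nat -> Om -> R) (I : R) (a g : R -> R -> R) :
  (forall n, (1 <= n)%N -> measurable_fun setT (l n)) ->
  0 < I ->
  (forall e : R, 0 < e ->
     (\sum_(1 <= n <oo) Q [set w | (l n w / n%:R <= I - e)%R] < +oo)%E) ->
  (forall al be, 0 < al < 1 -> 0 < be < 1 -> [/\ 0 < a al be,
     measurable_fun setT (T al be), (forall w, 0 <= T al be w)%E &
     forall n w, (1 <= n)%N -> a al be <= l n w -> (T al be w <= n%:R%:E)%E]) ->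
  asym_eq00 (fun al be => (a al be)%:E) g ->
  (forall C : R, exists2 del : R, 0 < del & forall al be : R,
     0 < al < del -> 0 < be < del -> C <= g al be) ->
  forall e : R, 0 < e -> exists2 del : R, 0 < del & forall al be : R,
    0 < al < del -> 0 < be < del -> al < 1 -> be < 1 ->
    (\int[Q]_w T al be w <= ((1 + e) * (g al be / I))%:E)%E.
Proof.
move=> ml I0 fin_sum hT ag goo e e0.
(* Chosen so that [(1 + e / 2) * (1 - e') = 1 + e']: the error in [a] and the loss from [I] to
   [I - eps] together use half of [e]. *)
pose e' := e / (4 + e).
have e40 : 0 < 4 + e by lra.
have e'0 : 0 < e' by rewrite divr_gt0.
have e'1 : 0 < 1 - e'.
  by rewrite subr_gt0 ltr_pdivrMr// mul1r ltrDr.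
pose eps := I * e'.
have eps0 : 0 < eps by rewrite mulr_gt0.
pose B n := [set w | (l n w / n%:R <= I - eps)%R].
have mB n : (1 <= n)%N -> measurable (B n).
  move=> n1; rewrite (_ : B n = (fun w => l n w / n%:R) @^-1` `]-oo, I - eps]); last first.
    by apply/seteqP; split=> w /=; rewrite in_itv.
  rewrite -[X in measurable X]setTI.
  by apply: measurable_funM => //; exact: ml.
pose S := (\sum_(1 <= n <oo) Q (B n))%E.
have S0 : (0 <= S)%E by exact: nneseries_ge0.
have Sfin : S \is a fin_num by rewrite ge0_fin_numE//; exact: fin_sum.
pose C := fine S.
have [del1 del10 Hdel1] := ag _ e'0.
(* This level of [g] makes [C + 1] fit into the other half, [e / 2 * (g al be / I)]. *)
have [del2 del20 Hdel2] := goo ((C + 1) * (2 * I / e)).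
exists (Num.min del1 del2); first by rewrite lt_min del10.
move=> al be; rewrite !lt_min => /andP[al0 /andP[ald1 ald2]] /andP[be0 /andP[bed1 bed2]] al1 be1.
have ai (x k : R) : 0 < x -> x < k -> 0 < x < k by move=> -> ->.
have [_] := Hdel1 al be (ai _ _ al0 ald1) (ai _ _ be0 bed1) al1 be1.
rewrite lee_fin => a_le.
have Cg := Hdel2 al be (ai _ _ al0 ald2) (ai _ _ be0 bed2).
have [a0 mT T0 Ta] := hT al be (ai _ _ al0 al1) (ai _ _ be0 be1).
have Ieps : 0 < I - eps.
  by rewrite (_ : I - eps = I * (1 - e')) ?mulr_gt0// /eps; ring.
pose M := Num.trunc (a al be / (I - eps)).
have Ma : M%:R <= a al be / (I - eps) by rewrite truncn_le divr_ge0// ltW.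
apply: le_trans (@expected_time_le_series _ _ _ Q _ B M mT T0 mB _) _.
  move=> n w Mn /negP; rewrite -ltNge => lB.
  have n1 : (1 <= n)%N by apply: leq_trans Mn.
  apply: Ta => //; move: lB; rewrite ltr_pdivlMr ?ltr0n// => /ltW; apply: le_trans.
  rewrite mulrC -ler_pdivrMr//; apply: le_trans (ltW (truncnS_gt _)) _.
  by rewrite ler_nat.
rewrite -[X in (_ + X)%E](fineK Sfin) -/C -EFinD lee_fin.
have aI : a al be / (I - eps) <= (1 + e / 2) * (g al be / I).
  rewrite ler_pdivrMr//; apply: (le_trans a_le).
  rewrite (_ : _ * (I - eps) = (1 + e / 2) * (1 - e') * g al be); last first.
    by rewrite /eps; field; rewrite gt_eqF.
  rewrite (_ : (1 + e / 2) * (1 - e') = 1 + e')//.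
  by rewrite /e'; field; rewrite gt_eqF.
have Cge : C + 1 <= e / 2 * (g al be / I).
  move: Cg; rewrite -ler_pdivlMr ?divr_gt0 ?mulr_gt0//.
  by rewrite (_ : g al be / (2 * I / e) = e / 2 * (g al be / I))//; field; rewrite !gt_eqF.
rewrite -natr1; lra.
Qed.

(* [G] is either [|ln al| / I] or [|ln be| / J]: halving [be] changes it by at
   most [ln 2 / J], which is negligible. *)
Lemma asym_eq00_squeeze (R : realType) (f L : R -> R -> \bar R) (g : R -> R -> R) :
  (forall al be, 0 < al < 1 -> 0 < be < 1 -> 0 <= g al be) ->
  (forall e : R, 0 < e -> exists2 del : R, 0 < del & forall al be : R,
    0 < al < del -> 0 < be < del -> al < 1 -> be < 1 ->
    `|g al (2 * be) - g al be| <= e * g al be /\ `|g al (be / 2) - g al be| <= e * g al be) ->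
  (forall e : R, 0 < e -> exists2 del : R, 0 < del & forall al be : R,
    0 < al < del -> 0 < be < del -> al < 1 -> be < 1 ->
    (f al be <= ((1 + e) * g al be)%:E)%E) ->
  (forall e : R, 0 < e -> exists2 del : R, 0 < del & forall al be : R,
    0 < al < del -> 0 < be < del -> al < 1 -> be < 1 ->
    (((1 - e) * g al be)%:E <= L al be)%E) ->
  (forall al be, 0 < al < 1 -> 0 < be < 1 -> (L al (2 * be)%R <= f al be)%E) ->
  asym_eq00 f g /\ asym_eq00 L g.
Proof.
move=> g0 gv fub Llb Lf.
have ai (x k : R) : 0 < x -> x < k -> 0 < x < k by move=> -> ->.
(* Small enough for both [(1 - e') ^+ 2 >= 1 - e] and [(1 + e') ^+ 2 <= 1 + e], since each direction
   loses [e'] twice. *)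
split=> e e0; pose e' := Num.min (e / 4) (1 / 2).
  have e'0 : 0 < e' by rewrite lt_min !divr_gt0.
  have e'e : e' <= e / 4 by rewrite ge_min lexx.
  have e'1 : e' <= 1 / 2 by rewrite ge_min lexx orbT.
  have [d1 d10 H1] := gv _ e'0; have [d2 d20 H2] := fub _ e0.
  have [d3 d30 H3] := Llb _ e'0.
  (* The last two entries keep [2 * be] below [d3] and below 1. *)
  exists (Num.min d1 (Num.min d2 (Num.min (d3 / 2) (1 / 2)))).
    by rewrite !lt_min d10 d20 !divr_gt0.
  move=> al be; rewrite !lt_min => /andP[al0 /and4P[al1 al2 al3 al4]].
  move=> /andP[be0 /and4P[be1 be2 be3 be4]] al01 be01.
  split; last by apply: H2; rewrite ?al0 ?be0.
  apply: le_trans (Lf _ _ (ai _ _ al0 al01) (ai _ _ be0 be01)).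
  apply: le_trans (H3 al (2 * be) _ _ _ _); rewrite ?al0//=; [|lra|lra|lra].
  rewrite lee_fin.
  have [+ _] := H1 al be (ai _ _ al0 al1) (ai _ _ be0 be1) al01 be01.
  rewrite ler_distl => /andP[+ _].
  have := g0 _ _ (ai _ _ al0 al01) (ai _ _ be0 be01).
  move: (g al be) (g al (2 * be)) => x y x0 xy; nra.
have e'0 : 0 < e' by rewrite lt_min !divr_gt0.
have e'e : e' <= e / 4 by rewrite ge_min lexx.
have e'1 : e' <= 1 / 2 by rewrite ge_min lexx orbT.
have [d1 d10 H1] := gv _ e'0; have [d2 d20 H2] := fub _ e'0.
have [d3 d30 H3] := Llb _ e0.
exists (Num.min d1 (Num.min d2 d3)); first by rewrite !lt_min d10 d20.
move=> al be; rewrite !lt_min => /andP[al0 /and3P[al1 al2 al3]].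
move=> /andP[be0 /and3P[be1 be2 be3]] al01 be01.
split; first by apply: H3; rewrite ?al0 ?be0.
(* The comparison of [L] with [f] is used at [be / 2], so that [L] is evaluated at [be] itself. *)
have be20 : 0 < be / 2 by lra.
have := Lf al (be / 2) (ai _ _ al0 al01); rewrite (_ : 2 * (be / 2) = be); last by lra.
move=> Lfb.
apply: (le_trans (Lfb _)); first by rewrite be20/=; lra.
apply: (le_trans (H2 al (be / 2) _ _ _ _)); rewrite ?al0 ?be20//=; [lra|lra|].
rewrite lee_fin.
have [_] := H1 al be (ai _ _ al0 al1) (ai _ _ be0 be1) al01 be01.
rewrite ler_distl => /andP[_].
have := g0 _ _ (ai _ _ al0 al01) (ai _ _ be0 be01).
move: (g al be) (g al (be / 2)) => x y x0 xy.
have e'2 : (1 + e') * (1 + e') <= 1 + e by nra.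
apply: (@le_trans _ _ ((1 + e') * ((1 + e') * x))); first by nra.
by rewrite mulrA ler_wpM2r.
Qed.

(** * The filtrations generated by the streams *)

Lemma sigma_algebra_setD (T : pointedType) (G : set (set T)) (A B : set T) :
  sigma_algebra setT G -> G A -> G B -> G (A `\` B).
Proof.
move=> sG; rewrite -(measurable_g_measurableTypeE sG) => mA mB.
exact: measurableD.
Qed.

Lemma sigma_algebra_fin_bigcap (T : pointedType) (I : Type) (G : set (set T))
    (D : set I) (A : I -> set T) :
  sigma_algebra setT G -> finite_set D -> (forall i, D i -> G (A i)) ->
  G (\bigcap_(i in D) A i).
Proof.
move=> sG fD; rewrite -(measurable_g_measurableTypeE sG) => mA.
exact: fin_bigcap_measurable.
Qed.

Section Filtration.
Context {d : measure_display} {Om : measurableType d}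
        {dS : measure_display} {S : measurableType dS} {K : nat}.
Variable X : 'I_K -> nat -> Om -> S.

Lemma Fk_sigma_algebra k n : sigma_algebra setT (Fk X k n).
Proof. exact: smallest_sigma_algebra. Qed.

Lemma Fk_le k m n : (m <= n)%N -> Fk X k m `<=` Fk X k n.
Proof.
move=> mn; apply: sub_sigma_algebra2 => E [t [B [/andP[t1 tm] H]]].
by exists t, B; rewrite t1 (leq_trans tm).
Qed.

Lemma Fk_Fall k n : Fk X k n `<=` Fall X n.
Proof. by apply: sub_sigma_algebra2 => E [t [B H]]; exists k, t, B. Qed.

Lemma Fk_sigmaX k n : Fk X k n `<=` sigmaX X k.
Proof.
by apply: sub_sigma_algebra2 => E [t [B [/andP[t1 _] H]]]; exists t, B.
Qed.

Lemma sigmaX_sigma_algebra k : sigma_algebra setT (sigmaX X k).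
Proof. exact: smallest_sigma_algebra. Qed.

Hypothesis mX : forall k t, measurable_fun setT (X k t).

Lemma Fk_measurable k n : Fk X k n `<=` measurable.
Proof.
apply: smallest_sub; first exact: sigma_algebra_measurable.
by move=> E [t [B [_ [mB ->]]]]; rewrite -[X in measurable X]setTI; exact: mX.
Qed.

End Filtration.

(** * Exit from a strip, truncated at a finite horizon *)

(** When no time from 1 to [N] lies outside the strip, [find] returns [N] and the value is the
    horizon [N.+1]. *)
Definition truncated_exit {R : realType} {Om : Type} (l : nat -> Om -> R)
    (a b : R) (N : nat) (w : Om) : nat :=
  (find (fun n => ~~ (- b < l n w < a)) (iota 1 N)).+1.

(** A path still inside the strip at the horizon is declared to carry no signal, so truncation can
    add missed detections but no false alarms. *)
Definition truncated_accept {R : realType} {Om : Type} (l : nat -> Om -> R)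
    (a b : R) (N : nat) (w : Om) : bool :=
  a <= l (truncated_exit l a b N w) w.

Section TruncatedExit.
Context {R : realType} {d : measure_display} {Om : measurableType d}.
Variables (l : nat -> Om -> R) (a b : R) (N : nat).
Let T := truncated_exit l a b N.

(** The clause [n <= N] reflects the forced stop at [N.+1]. In this form the event depends on [l]
    only up to time [n], which yields the stopping property. *)
Lemma truncated_exit_gt n w :
  (n < T w)%N <-> (n <= N)%N /\ forall m, (1 <= m <= n)%N -> - b < l m w < a.
Proof.
rewrite /T /truncated_exit ltnS; set p := fun n => _.
have [nN|Nn] := leqP n N; last first.
  split=> [nf|[]//]; have := leq_trans Nn nf.
  by rewrite ltnNge -[X in (_ <= X)%N](size_iota 1 N) find_size.
rewrite leqNgt -has_take_leq ?size_iota// take_iota (minn_idPl nN).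
split=> [/hasPn H|[_ H]].
  split=> // m mn; apply/negPn; apply: H.
  by rewrite mem_iota add1n ltnS.
by apply/hasPn => m; rewrite mem_iota add1n ltnS => /H; rewrite /p negbK.
Qed.

Lemma truncated_exit_inside w m : (1 <= m < T w)%N -> - b < l m w < a.
Proof. by move=> /andP[m1 /truncated_exit_gt[_]]; apply; rewrite m1/=. Qed.

Variable F : nat -> set (set Om).
Hypothesis sF : forall n, sigma_algebra setT (F n).
Hypothesis leF : forall m n, (m <= n)%N -> F m `<=` F n.
Hypothesis lF : forall n B, (1 <= n)%N -> measurable B -> F n (l n @^-1` B).

Let F_gt n : F n [set w | (n < T w)%N].
Proof.
have [nN|Nn] := leqP n N; last first.
  rewrite (_ : mkset _ = set0); first by case: (sF n).
  apply/seteqP; split=> // w /= /truncated_exit_gt[].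
  by rewrite leqNgt Nn.
rewrite (_ : mkset _ = \bigcap_(m in [set m | (1 <= m <= n)%N]) (l m @^-1` `]- b, a[)).
  apply: sigma_algebra_fin_bigcap => //.
    by apply: (@sub_finite_set _ _ `I_n.+1) => [m /= /andP[]//|]; exact: finite_II.
  by move=> m /= /andP[m1 mn]; apply: (leF mn); exact: lF.
apply/seteqP; split=> w /=.
  by move=> /truncated_exit_gt[_ H] m /H; rewrite /= in_itv.
by move=> H; apply/truncated_exit_gt; split=> // m /H; rewrite /= in_itv.
Qed.

Lemma truncated_exit_stopping_time : stopping_time F T.
Proof.
split=> // -[|n].
  by rewrite (_ : mkset _ = set0)//; [case: (sF 0)|apply/seteqP; split].
rewrite (_ : mkset _ = [set w | (n < T w)%N] `\` [set w | (n.+1 < T w)%N]).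
  by apply: sigma_algebra_setD => //; apply: (leF (leqnSn n)).
apply/seteqP; split=> w /=; first by move=> ->; rewrite ltnn.
by move=> [nT /negP]; rewrite -leqNgt => Tn; apply/eqP; rewrite eqn_leq Tn.
Qed.

Lemma truncated_accept_in_stopped :
  in_stopped F T [set w | truncated_accept l a b N w].
Proof.
have [_ FT] := truncated_exit_stopping_time.
case=> [|n].
  by rewrite (_ : _ `&` _ = set0); [case: (sF 0)|apply/seteqP; split=> w // [_ /=]].
rewrite (_ : _ `&` _ = l n.+1 @^-1` `[a, +oo[ `&` [set w | T w = n.+1]).
  by apply: sigma_algebra_setI => //; exact: lF.
apply/seteqP; split=> w [/= + Tn].
  by rewrite /truncated_accept -/T Tn in_itv/= andbT.
by rewrite /truncated_accept -/T Tn in_itv/= andbT.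
Qed.

End TruncatedExit.

(** * The SPRT and its truncation *)

Section SPRT.
Context {R : realType} {d : measure_display} {Om : measurableType d} {K : nat}.
Variables (lam : 'I_K -> nat -> Om -> R) (a b : R) (k : 'I_K).

Lemma sprt_T_le n w : (1 <= n)%N -> ~ (- b < lam k n w < a) ->
  (sprt_T lam a b k w <= n%:R%:E)%E.
Proof. by move=> n1 out; apply: ereal_inf_lbound; exists n. Qed.

Lemma truncated_exit_sprt_T N w :
  ((truncated_exit (lam k) a b N w)%:R%:E <= sprt_T lam a b k w)%E.
Proof.
apply: le_ereal_inf_tmp => _ [n [n1 out] <-]; rewrite lee_fin ler_nat leqNgt.
by apply/negP => nT; apply: out; apply: (truncated_exit_inside (N := N)); rewrite n1.
Qed.

Lemma sprt_T_ge0 w : (0 <= sprt_T lam a b k w)%E.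
Proof. by apply: le_ereal_inf_tmp => _ [n _ <-]; rewrite lee_fin. Qed.

(** At the truncated time the path is at or above [a] and was inside the strip before, so this is
    the genuine exit. *)
Lemma truncated_accept_sprt_D N w : 0 < a -> 0 < b ->
  truncated_accept (lam k) a b N w -> sprt_D lam a b k w.
Proof.
move=> a0 b0 acc; apply/asboolP; exists (truncated_exit (lam k) a b N w).
split=> //; last by move=> m; exact: truncated_exit_inside.
by move=> /andP[_]; rewrite ltNge => /negP; apply.
Qed.

(** Had the accepting exit come by time [N.+1], the truncated time would coincide with it and accept
    too. So the path is still inside the strip at [N.+1]. *)
Lemma sprt_D_truncated_accept N w :
  sprt_D lam a b k w -> ~~ truncated_accept (lam k) a b N w -> lam k N.+1 w < a.
Proof.
move=> /asboolP[n [n1 out ins acc]] rej.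
have [nN|Nn] := leqP n N.+1; last by have /andP[] := ins N.+1 Nn.
exfalso; move/negP: rej; apply.
suff Tn : truncated_exit (lam k) a b N w = n by rewrite /truncated_accept Tn.
apply/eqP; rewrite eqn_leq; apply/andP; split.
  rewrite leqNgt; apply/negP => nT; apply: out.
  by apply: (truncated_exit_inside (N := N)); rewrite n1.
case: n n1 out ins acc nN => // n _ out ins acc nN.
by apply/truncated_exit_gt; split=> // m /andP[m1 mn]; apply: ins; rewrite m1.
Qed.

Hypothesis mlam : forall n, (1 <= n)%N -> measurable_fun setT (lam k n).

Let m_inside n : (1 <= n)%N -> measurable [set w | - b < lam k n w < a].
Proof.
move=> n1; rewrite (_ : mkset _ = lam k n @^-1` `]- b, a[); last first.
  by apply/seteqP; split=> w /=; rewrite in_itv.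
by rewrite -[X in measurable X]setTI; exact: mlam.
Qed.

Lemma measurable_sprt_D : measurable [set w | sprt_D lam a b k w].
Proof.
rewrite (_ : mkset _ = \bigcup_(n in [set n | (1 <= n)%N])
  (~` [set w | - b < lam k n w < a] `&`
   \bigcap_(m in [set m | (1 <= m < n)%N]) [set w | - b < lam k m w < a] `&`
   lam k n @^-1` `[a, +oo[)).
  apply: bigcup_measurable => n n1; apply: measurableI; last first.
    by rewrite -[X in measurable X]setTI; exact: mlam.
  apply: measurableI; first by apply: measurableC; exact: m_inside.
  apply: fin_bigcap_measurable.
    by apply: (@sub_finite_set _ _ `I_n) => [m /= /andP[]//|]; exact: finite_II.
  by move=> m /= /andP[m1 _]; exact: m_inside.
apply/seteqP; split=> w /=.
  move=> /asboolP[n [n1 out ins acc]]; exists n => //.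
  by rewrite /= in_itv/= andbT.
move=> [n /= n1 [[out ins]]]; rewrite in_itv/= andbT => acc.
by apply/asboolP; exists n.
Qed.

Lemma measurable_sprt_T : measurable_fun setT (sprt_T lam a b k).
Proof.
(* Giving the value [+oo] to times inside the strip turns an infimum over a set depending on [w]
   into one over a fixed sequence of measurable functions. *)
pose f n w : \bar R := if (1 <= n)%N && ~~ (- b < lam k n w < a) then n%:R%:E else +oo%E.
rewrite (_ : sprt_T lam a b k = (fun w => einfs (f^~ w) 0%N)); last first.
  apply/funext => w; rewrite /einfs /sdrop; apply/eqP; rewrite eq_le; apply/andP; split.
    apply: le_ereal_inf_tmp => _ [n _ <-]; rewrite /f.
    by case: ifPn => [/andP[n1 /negP out]|_]; [exact: sprt_T_le|rewrite leey].
  apply: le_ereal_inf_tmp => _ [n [n1 /negP out] <-]; apply: ereal_inf_lbound.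
  by exists n => //; rewrite /f n1 out.
apply: measurable_fun_einfs => n; rewrite /f.
case: n => [|n]; first exact: measurable_cst.
apply: measurable_fun_ifT => //.
apply: (measurable_fun_bool true); rewrite setTI.
rewrite (_ : _ @^-1` _ = ~` [set w | - b < lam k n.+1 w < a]).
  by apply: measurableC; exact: m_inside.
by apply/seteqP; split=> w /= /negP.
Qed.

End SPRT.

(** * Positive drift carries the process past any level *)

Lemma nneseries_term_small (R : realType) (u : nat -> \bar R) (del : R) :
  (forall n, 0 <= u n)%E -> (\sum_(1 <= n <oo) u n < +oo)%E -> 0 < del ->
  \forall N \near \oo, (u N.+1 < del%:E)%E.
Proof.
move=> u0 su del0.
have := @nneseries_tail_cvg R (fun i => u (i + 1)%N) xpredT.
rewrite nneseries_addn// => /(_ su (fun k _ => u0 _)).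
move=> /cvge0_eventually_lt/(_ del0); apply: filterS => N; apply: le_lt_trans.
apply: le_trans (nneseries_lim_ge N.+1 _); last by [].
by rewrite big_nat1 addn1.
Qed.

(** Summability at [I / 2] makes the probability of [l n / n <= I / 2] vanish, and the line of slope
    [I / 2] eventually passes [c]. *)
Lemma drift_crossing d (Om : measurableType d) (R : realType)
    (Q : probability Om R) (l : nat -> Om -> R) (I : R) :
  (forall n, (1 <= n)%N -> measurable_fun setT (l n)) -> 0 < I ->
  (forall e : R, 0 < e ->
     (\sum_(1 <= n <oo) Q [set w | (l n w / n%:R <= I - e)%R] < +oo)%E) ->
  forall c del : R, 0 < del ->
    \forall N \near \oo, (Q [set w | (l N.+1 w < c)%R] < del%:E)%E.
Proof.
move=> ml I0 su c del del0.
have I20 : 0 < I / 2 by rewrite divr_gt0.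
have small := @nneseries_term_small _ _ _ (fun=> measure_ge0 Q _) (su _ I20) del0.
have big : \forall N \near \oo, c <= N.+1%:R * (I / 2).
  exists (Num.trunc (c / (I / 2))) => // N /= cN.
  rewrite -ler_pdivrMr//; apply: le_trans (ltW (truncnS_gt _)) _.
  by rewrite ler_nat.
apply: filterS2 small big => N small big; apply: le_lt_trans small.
apply: le_measure; rewrite ?inE.
- rewrite (_ : mkset _ = l N.+1 @^-1` `]-oo, c[); last first.
    by apply/seteqP; split=> w /=; rewrite in_itv.
  by rewrite -[X in measurable X]setTI; exact: ml.
- rewrite (_ : mkset _ = (fun w => l N.+1 w / N.+1%:R) @^-1` `]-oo, I - I / 2]); last first.
    by apply/seteqP; split=> w /=; rewrite in_itv.
  rewrite -[X in measurable X]setTI.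
  by apply: measurable_funM => //; exact: ml.
- move=> w /= lc; rewrite ler_pdivrMr ?ltr0n//.
  rewrite (_ : I - I / 2 = I / 2); last by lra.
  by rewrite mulrC; apply: ltW; apply: lt_le_trans lc _.
Qed.

(** * Comparing two laws through a bounded log-likelihood ratio *)

Section ChangeOfMeasure.
Context {d : measure_display} {Om : measurableType d} {R : realType}.
Variables (P0 P1 : probability Om R) (h : Om -> R) (E : set Om) (c : R).
Hypotheses (mh : measurable_fun setT h) (mE : measurable E).
Hypothesis P1E : P1 E = (\int[P0]_(w in E) (expR (h w))%:E)%E.

Let mexph : measurable_fun E (fun w => (expR (h w))%:E).
Proof.
apply: (measurable_funS measurableT) => //; apply/measurable_EFinP.
by apply: measurableT_comp mh; exact: measurable_expR.
Qed.

Lemma change_of_measure_le : E `<=` [set w | h w <= c] ->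
  (P1 E <= (expR c)%:E * P0 E)%E.
Proof.
move=> hc; rewrite P1E -integral_cst//; apply: ge0_le_integral => //.
by move=> w Ew; rewrite lee_fin ler_expR; exact: hc.
Qed.

(** The density is at least [expR (- c)] on [E]; multiplying through by [expR c] reverses the
    comparison without forming the reciprocal density. *)
Lemma change_of_measure_ge : E `<=` [set w | - h w <= c] ->
  (P0 E <= (expR c)%:E * P1 E)%E.
Proof.
move=> hc; have H : ((expR (- c))%:E * P0 E <= P1 E)%E.
  rewrite P1E -integral_cst//; apply: ge0_le_integral => //.
    by move=> w _; rewrite lee_fin expR_ge0.
  by move=> w Ew; rewrite lee_fin ler_expR lerNl; exact: hc.
have := @lee_wpmul2l _ (expR c)%:E _ _ _ H.
by rewrite muleA -EFinM -expRD subrr expR0 mul1e; apply; rewrite lee_fin expR_ge0.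
Qed.

End ChangeOfMeasure.

(** * Logarithms near zero *)

Section LogAsymptotics.
Context {R : realType}.

Lemma le_norm_ln (C x : R) : 0 < x < expR (- C) -> C <= `|ln x|.
Proof.
move=> /andP[x0 xC]; rewrite -normrN; apply: le_trans (ler_norm _).
by rewrite lerNr -ler_expR lnK// ltW.
Qed.

Lemma norm_ln_scale_small (e : R) : 0 < e -> exists2 del : R, 0 < del &
  forall x : R, 0 < x < del -> `| `|ln (2 * x)| - `|ln x| | <= e * `|ln x| /\
    `| `|ln (x / 2)| - `|ln x| | <= e * `|ln x|.
Proof.
move=> e0; have ln20 : 0 < ln 2 :> R by rewrite ln_gt0// ltr1n.
(* Below [1 / 2] all three logarithms are nonpositive, so the moduli differ by exactly [ln 2]; the
   other bound makes [ln 2] at most [e] times the modulus of [ln x]. *)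
exists (Num.min (1 / 2) (expR (- (ln 2 / e)))).
  by rewrite lt_min expR_gt0 divr_gt0.
move=> x; rewrite lt_min => /andP[x0 /andP[x2 xe]].
have : ln 2 <= e * `|ln x|.
  by rewrite mulrC -ler_pdivrMr//; apply: le_norm_ln; rewrite x0.
move=> le_e.
have lnx : ln x <= 0 by rewrite ln_le0//; lra.
have ln2x : ln (2 * x) <= 0 by rewrite ln_le0//; lra.
have lnx2 : ln (x / 2) <= 0 by rewrite ln_le0//; lra.
rewrite !(ler0_norm lnx) !(ler0_norm ln2x) !(ler0_norm lnx2).
rewrite (ler0_norm lnx) in le_e.
by rewrite lnM ?posrE// ln_div ?posrE//; split; rewrite ler_norml; lra.
Qed.

End LogAsymptotics.

(** * Comparing the infimum over decentralized procedures with the SPRT *)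

Section Procedures.
Context {R : realType} {d : measure_display} {Om : measurableType d}
        {dS : measure_display} {S : measurableType dS} {K : nat}.
Variables (X : 'I_K -> nat -> Om -> S) (P1 : 'I_K -> probability Om R)
  (P : {set 'I_K} -> probability Om R) (lam : 'I_K -> nat -> Om -> R)
  (Pi : {set {set 'I_K}}).
Hypothesis mX : forall k t, measurable_fun setT (X k t).
Hypothesis lF : forall k n B, (1 <= n)%N -> measurable B ->
  Fk X k n (lam k n @^-1` B).

Lemma measurable_some_event (Z : pred 'I_K) (D : 'I_K -> set Om) :
  (forall k, measurable (D k)) -> measurable [set w | exists k, Z k /\ D k w].
Proof.
move=> mD; rewrite (_ : mkset _ = \bigcup_(k in [set k | Z k]) D k).
  by apply: fin_bigcup_measurable => // k _; exact: mD.
by apply/seteqP; split=> w [k]; [case=> Zk Dk|move=> Zk Dk]; exists k.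
Qed.

Lemma measurable_negb (Z : Om -> bool) :
  measurable [set w | Z w] -> measurable [set w | ~~ Z w].
Proof.
move=> mZ; rewrite (_ : mkset _ = ~` [set w | Z w]); first exact: measurableC.
by apply/seteqP; split=> w /= /negP.
Qed.

Lemma le_FWE1 (A : {set 'I_K}) (D : 'I_K -> Om -> bool) (D' : set Om) (j : 'I_K) :
  (forall k, measurable [set w | D k w]) -> measurable D' ->
  j \notin A -> D' `<=` [set w | D j w] -> (P A D' <= FWE1 P A D)%E.
Proof.
move=> mD mD' jA D'D; apply: le_measure; rewrite ?inE//.
  exact: (measurable_some_event (fun k => k \notin A) mD).
by move=> w /D'D Dw; exists j.
Qed.

Lemma le_FWE2 (A : {set 'I_K}) (D : 'I_K -> Om -> bool) (D' : set Om) (i : 'I_K) :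
  (forall k, measurable [set w | D k w]) -> measurable D' ->
  i \in A -> D' `<=` [set w | ~~ D i w] -> (P A D' <= FWE2 P A D)%E.
Proof.
move=> mD mD' iA D'D; apply: le_measure; rewrite ?inE//.
  apply: (measurable_some_event (fun k => k \in A)) => k.
  exact: measurable_negb.
by move=> w /D'D Dw; exists i.
Qed.

Hypothesis PA1 : forall (A : {set 'I_K}) k E, k \in A -> sigmaX X k E -> P A E = P1 k E.
Hypothesis crossing : forall k (c del : R), 0 < del ->
  \forall N \near \oo, (P1 k [set w | (lam k N.+1 w < c)%R] < del%:E)%E.

(* The untruncated test need not stop everywhere, so it is cut at a horizon so
   late that this costs at most [be] in the second error probability. *)
Lemma Lprime_le_sprt (al be a b : R) (k : 'I_K) (A : {set 'I_K}) :
  0 < be -> 0 < a -> 0 < b -> errors_ok P Pi al be (sprt_D lam a b) ->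
  (Lprime X P Pi al (2 * be)%R k A <= \int[P A]_w sprt_T lam a b k w)%E.
Proof.
move=> be0 a0 b0 err.
have K0 : (0 < K)%N by case: k => k; case: (K).
have beK : 0 < be / K%:R by rewrite divr_gt0// ltr0n.
(* One horizon serves all streams, and the share [be / K%:R] makes the union over streams cost at
   most [be]. *)
have [N _ HN] : \forall N \near \oo,
    forall i, (P1 i [set w | (lam i N.+1 w < a)%R] < (be / K%:R)%:E)%E.
  by apply: filter_forall => i; exact: crossing.
have {}HN i := HN N (leqnn N) i.
pose T i := truncated_exit (lam i) a b N.
pose D i := truncated_accept (lam i) a b N.
have sT i : stopping_time (Fk X i) (T i).
  apply: truncated_exit_stopping_time => [n|m n mn|n B]; [|exact: Fk_le|exact: lF].
  exact: Fk_sigma_algebra.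
have sD i : in_stopped (Fk X i) (T i) [set w | D i w].
  apply: truncated_accept_in_stopped => [n|m n mn|n B]; [|exact: Fk_le|exact: lF].
  exact: Fk_sigma_algebra.
have mT i n : measurable [set w | T i w = n].
  by apply: (Fk_measurable mX (k := i) (n := n)); case: (sT i).
have mD i : measurable [set w | D i w].
  by apply: measurable_in_stopped (sD i) => n; exact: Fk_measurable.
have mlam i n : (1 <= n)%N -> measurable_fun setT (lam i n).
  by move=> n1 _ B mB; rewrite setTI; apply: (Fk_measurable mX); exact: lF.
have mlt i : measurable [set w | (lam i N.+1 w < a)%R].
  rewrite (_ : mkset _ = lam i N.+1 @^-1` `]-oo, a[); last first.
    by apply/seteqP; split=> w /=; rewrite in_itv.
  by rewrite -[X in measurable X]setTI; exact: mlam.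
have mS i : measurable [set w | sprt_D lam a b i w].
  by apply: measurable_sprt_D; exact: mlam.
apply: (@le_trans _ _ (\int[P A]_w ((T k w)%:R)%:E)%E); last first.
  apply: ge0_le_integral => //.
  - exact: measurable_nat_time.
  - by apply: measurable_sprt_T; exact: mlam.
  - by move=> w _; exact: truncated_exit_sprt_T.
apply: ereal_inf_lbound; exists T, D; split; [split|split=> //] => [i|i|].
- have [T1 FT] := sT i; split; first by split=> // n; apply: Fk_Fall.
  by move=> n; apply: Fk_Fall; exact: sD.
- by split; [exact: sT|exact: sD].
move=> B BPi; have [e1 e2] := err B BPi; split.
  apply: le_trans e1; apply: le_measure; rewrite ?inE.
  - exact: (measurable_some_event (fun k => k \notin B) mD).
  - exact: (measurable_some_event (fun k => k \notin B) mS).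
  - by move=> w [j [jB Dj]]; exists j; split=> //; exact: truncated_accept_sprt_D Dj.
(* A signal missed by the truncated test is either missed by the SPRT or accepted by it only past
   the horizon; the latter path lies below [a] at [N.+1], hence in [G i]. *)
pose G i := if i \in B then [set w | (lam i N.+1 w < a)%R] else set0.
have mG i : measurable (G i) by rewrite /G; case: ifP.
have mUG : measurable (\bigcup_i G i) by exact: fin_bigcup_measurable.
have m1 : measurable [set w | exists i, i \in B /\ ~~ sprt_D lam a b i w].
  by apply: (measurable_some_event (fun k => k \in B)) => i; exact: measurable_negb.
have PBi i : i \in B -> (P B [set w | (lam i N.+1 w < a)%R] <= (be / K%:R)%:E)%E.
  move=> iB; rewrite (PA1 iB); first exact: ltW.
  apply: (@Fk_sigmaX _ _ _ _ _ X i N.+1).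
  rewrite (_ : mkset _ = lam i N.+1 @^-1` `]-oo, a[); first exact: lF.
  by apply/seteqP; split=> w /=; rewrite in_itv.
have PG : (P B (\bigcup_i G i) <= be%:E)%E.
  apply: le_trans (measure_finite_union_le (x := be / K%:R) mUG mG _ _) _ => //.
    by move=> i; rewrite /G; case: ifP => [/PBi//|_]; rewrite measure0 lee_fin ltW.
  by rewrite card_ord lee_fin -(mulr_natr (be / K%:R)) divfK// pnatr_eq0 -lt0n.
rewrite /FWE2 (_ : 2 * be = be + be); last by ring.
rewrite EFinD; apply: le_trans (leeD e2 PG).
apply: le_trans (measureU2 _ m1 mUG); apply: le_measure; rewrite ?inE.
- by apply: (measurable_some_event (fun k => k \in B)) => i; exact: measurable_negb.
- exact: measurableU.
- move=> w [i [iB nD]]; have [Sw|nS] := boolP (sprt_D lam a b i w).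
    right; exists i => //; rewrite /G iB /=.
    exact: sprt_D_truncated_accept Sw nD.
  by left; exists i.
Qed.

End Procedures.

(** * Transfer from the law of one stream to the joint law *)

Section Marginal.
Context {R : realType} {d : measure_display} {Om : measurableType d}
        {dS : measure_display} {S : measurableType dS} {K : nat}.
Variables (X : 'I_K -> nat -> Om -> S) (k : 'I_K) (Q Qk : probability Om R)
  (l : nat -> Om -> R) (I : R).
Hypothesis mX : forall k t, measurable_fun setT (X k t).
Hypothesis lF : forall n B, (1 <= n)%N -> measurable B -> Fk X k n (l n @^-1` B).
Hypothesis QE : forall E, sigmaX X k E -> Q E = Qk E.
Hypothesis I0 : 0 < I.

Let ml n : (1 <= n)%N -> measurable_fun setT (l n).
Proof. by move=> n1 _ B mB; rewrite setTI; apply: (Fk_measurable mX); exact: lF. Qed.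

Lemma marginal_running_max :
  Qk [set w | (limn_esup (fun n => (l n w / n%:R)%:E) <= I%:E)%E] = 1%E ->
  forall del : R, 0 < del -> forall eps : R, 0 < eps ->
  exists M, forall m, (M <= m)%N ->
    (Q [set w | exists n, (1 <= n <= m)%N /\ (m%:R * (I + eps) < l n w)%R] <= del%:E)%E.
Proof.
move=> Qk1 del del0 eps eps0.
have [M HM] := running_max_small ml I0 eps0 Qk1 del0.
exists M => m Mm; rewrite QE ?HM//.
(* Taking [sigmaX X k] as the measurable structure places the running-maximum event where [Q] and
   [Qk] agree. *)
rewrite -(measurable_g_measurableTypeE (sigmaX_sigma_algebra X k)).
apply: measurable_running_max => n n1.
rewrite measurable_g_measurableTypeE; last exact: sigmaX_sigma_algebra.
apply: (@Fk_sigmaX _ _ _ _ _ X k n).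
rewrite (_ : mkset _ = l n @^-1` `]-oo, m%:R * (I + eps)]); first exact: lF.
by apply/seteqP; split=> w /=; rewrite in_itv.
Qed.

Lemma marginal_series (e : R) :
  (\sum_(1 <= n <oo) Qk [set w | (l n w / n%:R <= I - e)%R] < +oo)%E ->
  (\sum_(1 <= n <oo) Q [set w | (l n w / n%:R <= I - e)%R] < +oo)%E.
Proof.
(* After the shift only times of the form [n + 1] occur, at which the events belong to the stream's
   filtration. *)
rewrite -!(nneseries_addn (f := fun n => _ [set w | (l n w / n%:R <= I - e)%R]) 1)//.
under [in X in _ -> X]eq_eseriesr => n _.
  rewrite QE; last first.
    apply: (@Fk_sigmaX _ _ _ _ _ X k (n + 1)).
    rewrite (_ : mkset _ = l (n + 1)%N @^-1` `]-oo, (I - e) * (n + 1)%:R]).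
      by apply: lF => //; rewrite addn1.
    by apply/seteqP; split=> w /=; rewrite in_itv/= ler_pdivrMr// ltr0n addn1.
  over.
by [].
Qed.

End Marginal.

(** * Matching bounds for streams with and without signal *)

Theorem theorem5p3 (R : realType) (d : measure_display) (Omega : measurableType d)
  (dS : measure_display) (S : measurableType dS) (K : nat) (hK : (0 < K)%N)
  (X : 'I_K -> nat -> Omega -> S)
  (P0 P1 : 'I_K -> probability Omega R)
  (P : {set 'I_K} -> probability Omega R)
  (lam : 'I_K -> nat -> Omega -> R)
  (Pi : {set {set 'I_K}})
  (a b : R -> R -> R)
  (I J : 'I_K -> R) :
  (* the streams are random elements *)
  (forall k t, measurable_fun setT (X k t)) ->
  (* P_A : independent streams, X_k ~ P_k^1 if k in A, P_k^0 otherwise *)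
  (forall A (E : 'I_K -> set Omega), (forall k, sigmaX X k (E k)) ->
     P A (\bigcap_(k in [set: 'I_K]) E k) = (\prod_(k < K) P A (E k))%E) ->
  (forall A k E, sigmaX X k E ->
     P A E = (if k \in A then P1 k E else P0 k E)) ->
  (* lam k n = log dP_k^1/dP_k^0 on F_k(n) (mutual absolute continuity follows) *)
  (forall k n, (1 <= n)%N ->
     (forall B : set R, measurable B -> Fk X k n (lam k n @^-1` B)) /\
     (forall E, Fk X k n E -> P1 k E = (\int[P0 k]_(w in E) (expR (lam k n w))%:E)%E)) ->
  (* assumption on Pi *)
  (forall k, exists A B, [/\ A \in Pi, B \in Pi, k \in A & k \notin B]) ->
  (* thresholds *)
  (forall al be, 0 < al < 1 -> 0 < be < 1 ->
     [/\ 0 < a al be, 0 < b al be & errors_ok P Pi al be (sprt_D lam (a al be) (b al be))]) ->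
  asym_eq00 (fun al be => (a al be)%:E) (fun al be => `|ln al|) ->
  asym_eq00 (fun al be => (b al be)%:E) (fun al be => `|ln be|) ->
  (* information numbers *)
  (forall k, 0 < I k /\ 0 < J k) ->
  (forall k, P1 k [set w | (limn_esup (fun n => (lam k n w / n%:R)%:E) <= (I k)%:E)%E] = 1%E) ->
  (forall k, P0 k [set w | (limn_esup (fun n => (- lam k n w / n%:R)%:E) <= (J k)%:E)%E] = 1%E) ->
  (forall k (e : R), 0 < e ->
     (\sum_(1 <= n <oo) P1 k [set w | (lam k n w / n%:R <= I k - e)%R] < +oo)%E) ->
  (forall k (e : R), 0 < e ->
     (\sum_(1 <= n <oo) P0 k [set w | (- lam k n w / n%:R <= J k - e)%R] < +oo)%E) ->
  forall A, A \in Pi ->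
    (forall i, i \in A ->
       asym_eq00 (fun al be => (\int[P A]_w sprt_T lam (a al be) (b al be) i w)%E)
                 (fun al be => `|ln al| / I i) /\
       asym_eq00 (fun al be => Lprime X P Pi al be i A) (fun al be => `|ln al| / I i)) /\
    (forall j, j \notin A ->
       asym_eq00 (fun al be => (\int[P A]_w sprt_T lam (a al be) (b al be) j w)%E)
                 (fun al be => `|ln be| / J j) /\
       asym_eq00 (fun al be => Lprime X P Pi al be j A) (fun al be => `|ln be| / J j)).

Proof.
move=> mX _ marg dens hPi hthr a_asym b_asym IJ0 limsup1 limsup0 sum1 sum0 A APi.
have lF k n B : (1 <= n)%N -> measurable B -> Fk X k n (lam k n @^-1` B).
  by move=> n1 mB; have [+ _] := dens k n n1; apply.
have NlF k n B : (1 <= n)%N -> measurable B ->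
    Fk X k n ((fun w => - lam k n w) @^-1` B).
  move=> n1 mB; rewrite (_ : _ @^-1` _ = lam k n @^-1` (-%R @^-1` B))//.
  by apply: lF => //; rewrite -[X in measurable X]setTI; exact: oppr_measurable.
have mlam k n : (1 <= n)%N -> measurable_fun setT (lam k n).
  by move=> n1 _ B mB; rewrite setTI; apply: (Fk_measurable mX); exact: lF.
have mNlam k n : (1 <= n)%N -> measurable_fun setT (fun w => - lam k n w).
  by move=> n1 _ B mB; rewrite setTI; apply: (Fk_measurable mX); exact: NlF.
have PA1 (B : {set 'I_K}) k E : k \in B -> sigmaX X k E -> P B E = P1 k E.
  by move=> kB sE; rewrite (marg _ _ _ sE) kB.
have PA0 (B : {set 'I_K}) k E : k \notin B -> sigmaX X k E -> P B E = P0 k E.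
  by move=> /negPf kB sE; rewrite (marg _ _ _ sE) kB.
have crossing k (c del : R) : 0 < del ->
    \forall N \near \oo, (P1 k [set w | (lam k N.+1 w < c)%R] < del%:E)%E.
  move=> del0; have [I0 _] := IJ0 k.
  exact: (drift_crossing (mlam k) I0 (sum1 k)).
have Lf k al be : 0 < al < 1 -> 0 < be < 1 ->
    (Lprime X P Pi al (2 * be)%R k A <=
     \int[P A]_w sprt_T lam (a al be) (b al be) k w)%E.
  move=> al01 be01; have [a0 b0 err] := hthr _ _ al01 be01.
  by have /andP[be0 _] := be01; exact: (Lprime_le_sprt mX lF PA1 crossing).
have sF k n : sigma_algebra setT (Fk X k n) by exact: Fk_sigma_algebra.
have mF k n : Fk X k n `<=` measurable by exact: Fk_measurable.
split=> [i iA|j jA].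
  (* A configuration [B] in [Pi] without [i] is the alternative law: under it deciding 1 on stream
     [i] is a false alarm, controlled by [al]. *)
  have [I0 _] := IJ0 i; have [_ [B [_ BPi _ iB]]] := hPi i.
  apply: asym_eq00_squeeze => //.
  - by move=> al be _ _; rewrite divr_ge0// ltW.
  - move=> e e0; exists 1 => // al be _ _ _ _; rewrite subrr normr0.
    by rewrite !mulr_ge0// ?invr_ge0 ltW.
  - apply: (@expected_time_upper_asym _ _ _ (P A) _ (lam i) (I i) a
      (fun al be => `|ln al|)) => //.
    + exact: mlam.
    + move=> e e0; apply: (marginal_series (X := X) (k := i) (Qk := P1 i)).
      * exact: lF.
      * by move=> E; exact: PA1.
      * exact: sum1.
    + move=> al be al01 be01; have [a0 b0 _] := hthr _ _ al01 be01; split=> //.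
      * by apply: measurable_sprt_T; exact: mlam.
      * by move=> w; exact: sprt_T_ge0.
      * move=> n w n1 al_lam; apply: sprt_T_le => // /andP[_].
        by rewrite ltNge al_lam.
    + move=> C; exists (expR (- C)); first exact: expR_gt0.
      by move=> al be al0 _; exact: le_norm_ln.
  - move=> e e0.
    (* On events of stream [i] alone, where decentralized rules live, [P A] and [P B] reduce to
       [P1 i] and [P0 i], however much they differ on other streams. *)
    have chg n E c : (1 <= n)%N -> Fk X i n E -> E `<=` [set w | (lam i n w <= c)%R] ->
        (P A E <= (expR c)%:E * P B E)%E.
      move=> n1 FE Ec; have sE := Fk_sigmaX FE.
      rewrite (PA1 _ _ _ iA sE) (PA0 _ _ _ iB sE).
      apply: change_of_measure_le Ec; [exact: mlam|exact: (mF i n)|].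
      by have [_] := dens i n n1; apply.
    have tail := marginal_running_max mX (lF i) (fun E => @PA1 A i E iA) I0 (limsup1 i).
    have [del del0 Hdel] := expected_time_lower_bound (sF i) (mF i) (lF i) chg I0 tail e0.
    (* As [del] is independent of the procedure, the bound passes to the infimum. *)
    exists del => // al be ald bed _ _; apply: le_ereal_inf_tmp => _ [T [D [[_ dec] [err ->]]]].
    have mD k : measurable [set w | D k w].
      by have [_ DF] := dec k; apply: measurable_in_stopped DF; exact: mF.
    have [Ti Di] := dec i.
    apply: (Hdel al be _ _ ald bed Ti Di).
    + by have [+ _] := err B BPi; apply: le_trans; exact: (le_FWE1 P mD (mD i) iB).
    + have [_] := err A APi; apply: le_trans; apply: (le_FWE2 P mD (measurableC (mD i)) iA).
      by move=> w /= /negP.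
  - exact: Lf.
(* Here [B] contains [j], so that under [P B] deciding 0 on stream [j] is a missed detection,
   controlled by [be]. *)
have [_ J0] := IJ0 j; have [B [_ [BPi _ jB _]]] := hPi j.
apply: asym_eq00_squeeze => //.
- by move=> al be _ _; rewrite divr_ge0// ltW.
- move=> e e0; have [del del0 Hdel] := norm_ln_scale_small e0.
  exists del => // al be _ bed _ _; have [H1 H2] := Hdel be bed.
  by rewrite -!mulrBl !normrM !(ger0_norm (x := (J j)^-1)) ?invr_ge0 ?(ltW J0)//
    !mulrA !ler_wpM2r// invr_ge0 ltW.
- apply: (@expected_time_upper_asym _ _ _ (P A) _ (fun n w => - lam j n w) (J j) b
    (fun al be => `|ln be|)) => //.
  + exact: mNlam.
  + move=> e e0; apply: (marginal_series (X := X) (k := j) (Qk := P0 j)).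
    * exact: NlF.
    * by move=> E; exact: PA0.
    * exact: sum0.
  + move=> al be al01 be01; have [a0 b0 _] := hthr _ _ al01 be01; split=> //.
    * by apply: measurable_sprt_T; exact: mlam.
    * by move=> w; exact: sprt_T_ge0.
    * move=> n w n1 be_lam; apply: sprt_T_le => // /andP[+ _].
      by rewrite ltrNl ltNge be_lam.
  + move=> C; exists (expR (- C)); first exact: expR_gt0.
    by move=> al be _ be0; exact: le_norm_ln.
- move=> e e0.
  have chg n E c : (1 <= n)%N -> Fk X j n E -> E `<=` [set w | (- lam j n w <= c)%R] ->
      (P A E <= (expR c)%:E * P B E)%E.
    move=> n1 FE Ec; have sE := Fk_sigmaX FE.
    rewrite (PA0 _ _ _ jA sE) (PA1 _ _ _ jB sE).
    apply: change_of_measure_ge Ec; [exact: mlam|exact: (mF j n)|].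
    by have [_] := dens j n n1; apply.
  have tail := marginal_running_max mX (NlF j) (fun E => @PA0 A j E jA) J0 (limsup0 j).
  have [del del0 Hdel] := expected_time_lower_bound (sF j) (mF j) (NlF j) chg J0 tail e0.
  exists del => // al be ald bed _ _; apply: le_ereal_inf_tmp => _ [T [D [[_ dec] [err ->]]]].
  have mD k : measurable [set w | D k w].
    by have [_ DF] := dec k; apply: measurable_in_stopped DF; exact: mF.
  have [[T1 FT] Dj] := dec j.
  (* The event of deciding 0 plays the part of [H] and [- lam j] that of [l], so [be] and [al] trade
     places. *)
  apply: (Hdel be al _ (~` [set w | D j w]) bed ald (conj T1 FT)).
  + move=> n; rewrite (_ : _ `&` _ = [set w | T j w = n] `\`
        ([set w | D j w] `&` [set w | T j w = n])).
      exact: (sigma_algebra_setD (sF j n) (FT n) (Dj n)).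
    apply/seteqP; split=> w; first by move=> [nD Tn]; split=> // -[].
    by move=> [Tn nDT]; split=> // Dw; exact: nDT.
  + have [_] := err B BPi; apply: le_trans; apply: (le_FWE2 P mD (measurableC (mD j)) jB).
    by move=> w /= /negP.
  + rewrite setCK; have [+ _] := err A APi; apply: le_trans; exact: (le_FWE1 P mD (mD j) jA).
- exact: Lf.
Qed.
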